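(* Let $A$ be a positive information algebra, let $L$ be a well-ordered set disjoint from $A$, and let $S=A\uplus_{\mathrm{ord}}L$ be the overflow semiring. Then $S$ is Noetherian if and only if $A$ is Noetherian.
   Context: All semirings are commutative: $(S,+,0)$ and $(S,\cdot,1)$ are commutative monoids, $1\neq 0$, multiplication distributes over addition, and $0$ is absorbing. A semiring is zerosumfree if $a+b=0$ implies $a=b=0$, and entire if $ab=0$ implies $a=0$ or $b=0$; an information algebra is a zerosumfree entire semiring. A positive information algebra is an information algebra with a partial order $\leq$ compatible with $+$ and $\cdot$ (i.e. $x\leq y$ implies $x+z\leq y+z$ and $xz\leq yz$) and having $0$ as least element. An ideal of a semiring $S$ is a nonempty subset $I$ with $a+b\in I$ and $sa\in I$ for all $a,b\in I$, $s\in S$. A semiring is Noetherian if every ideal is finitely generated (equivalently, it satisfies the ascending chain condition on ideals). Overflow semiring $S=A\uplus_{\mathrm{ord}}L$: for a positive information algebra $A$ and a join-semilattice $L$ disjoint from $A$, $S=A\cup L$ with the order extending those of $A$ and $L$ by $a\leq\ell$ for all $a\in A,\ell\in L$ (and never $\ell\leq a$), and operations: $x+y=x+_Ay$ if $x,y\in A$, $x+y=\sup\{x,y\}$ otherwise; $xy=x\cdot_Ay$ if $x,y\in A\setminus\{0\}$, $xy=0$ if $x=0$ or $y=0$, and $xy=\sup\{x,y\}$ otherwise. With these, $S$ is a positive information algebra. *)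

(* Defs.v *)
From HB Require Import structures.
From mathcomp Require Import all_boot all_order all_algebra.
From mathcomp Require Import all_classical.
From mathcomp Require wochoice.

Set Implicit Arguments.
Unset Strict Implicit.
Unset Printing Implicit Defensive.

Import Order.TTheory GRing.Theory.
Local Open Scope classical_set_scope.
Local Open Scope ring_scope.

HB.mixin Record isInfoAlgebra A of GRing.ComNzSemiRing A := {
  zerosumfree : forall a b : A, a + b = 0 -> a = 0 /\ b = 0;
  entire : forall a b : A, a * b = 0 -> a = 0 \/ b = 0
}.

#[short(type="infoAlgebraType")]
HB.structure Definition InfoAlgebra :=
  { A of GRing.ComNzSemiRing A & isInfoAlgebra A }.

(* The order is a field of the mixin because Num.POrderedZmodule is already the
   library's join of additive structures and orders, and it requires opposites. *)
HB.mixin Record InfoAlgebra_isPositive A of InfoAlgebra A := {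
  ple : rel A;
  ple_order : wochoice.partial_order ple;
  pleD2r : forall z x y : A, ple x y -> ple (x + z) (y + z);
  pleM2r : forall z x y : A, ple x y -> ple (x * z) (y * z);
  ple0x : forall x : A, ple 0 x
}.

#[short(type="posInfoAlgebraType")]
HB.structure Definition PosInfoAlgebra :=
  { A of InfoAlgebra A & InfoAlgebra_isPositive A }.

Definition ideal (S : comNzSemiRingType) (I : set S) : Prop :=
  [/\ I !=set0,
      forall a b : S, I a -> I b -> I (a + b) &
      forall s a : S, I a -> I (s * a)].

Definition finitely_generated (S : comNzSemiRingType) (I : set S) : Prop :=
  exists2 G : set S, finite_set G & I = smallest (@ideal S) G.

Definition noetherian (S : comNzSemiRingType) : Prop :=
  forall I : set S, ideal I -> finitely_generated I.

(* The disjoint union of A and L is rendered by the sum type. *)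
Definition overflow (A : posInfoAlgebraType) (d : Order.disp_t)
  (L : joinSemilatticeType d) : Type := (A + L)%type.

Section Overflow.
Variables (A : posInfoAlgebraType) (d : Order.disp_t).
Variable L : joinSemilatticeType d.
Notation S := (overflow A L).

HB.instance Definition _ := Choice.copy S (A + L)%type.

Definition overflow_le (x y : S) : bool :=
  match x, y with
  | inl a, inl b => ple a b
  | inl _, inr _ => true
  | inr _, inl _ => false
  | inr l, inr m => (l <= m)%O
  end.

Fact overflow_le_order : wochoice.partial_order overflow_le.
Proof.
have [[rA tA] aA] := @ple_order A.
split; first split.
- by case=> x /=; [exact: rA | exact: lexx].
- by move=> [b|m] [a|l] [c|n] //=; [exact: tA | exact: le_trans].
- by move=> [a|l] [b|m] //= => [/aA ->|/le_anti ->].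
Qed.

(* The supremum of {x, y} in S when x or y lies in L (see overflow_sup_lub);
   the value on A * A is a dummy, A having no suprema in general. *)
Definition overflow_sup (x y : S) : S :=
  match x, y with
  | inl _, inl _ => x
  | inl _, inr m => inr m
  | inr l, inl _ => inr l
  | inr l, inr m => inr (Order.join l m)
  end.

Definition inL (x : S) : bool := if x is inr _ then true else false.

Lemma overflow_sup_lub (x y : S) : inL x || inL y ->
  forall z : S,
    overflow_le (overflow_sup x y) z = overflow_le x z && overflow_le y z.
Proof.
case: x y => [a|l] [b|m] //= _ [c|n] //=; rewrite ?andbF ?andbT //.
exact: leUx.
Qed.

Definition overflow_add (x y : S) : S :=
  match x, y with
  | inl a, inl b => inl (a + b)
  | _, _ => overflow_sup x y
  end.

Definition overflow_zero : S := inl 0.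
Definition overflow_one : S := inl 1.

Definition overflow_mul (x y : S) : S :=
  if (x == overflow_zero) || (y == overflow_zero) then overflow_zero else
  match x, y with
  | inl a, inl b => inl (a * b)
  | _, _ => overflow_sup x y
  end.

Fact overflow_addA : associative overflow_add.
Proof. by move=> [a|l] [b|m] [c|n] //=; rewrite ?addrA ?joinA. Qed.

Fact overflow_addC : commutative overflow_add.
Proof. by move=> [a|l] [b|m] //=; [rewrite addrC | rewrite joinC]. Qed.

Fact overflow_add0 : left_id overflow_zero overflow_add.
Proof. by case=> [a|l] //=; rewrite add0r. Qed.

HB.instance Definition _ :=
  GRing.isNmodule.Build S overflow_addA overflow_addC overflow_add0.

Let inl0E (a : A) : (inl a == overflow_zero :> S) = (a == 0).
Proof. by []. Qed.

Let inr0E (l : L) : (inr l == overflow_zero :> S) = false.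
Proof. by []. Qed.

Let mulf0E (a b : A) : (a * b == 0) = (a == 0) || (b == 0).
Proof.
apply/eqP/orP => [/entire[]->|[]/eqP->]; rewrite ?eqxx ?mul0r ?mulr0; auto.
Qed.

Let addf0E (a b : A) : (a + b == 0) = (a == 0) && (b == 0).
Proof.
apply/eqP/andP => [/zerosumfree[-> ->]|[/eqP-> /eqP->]]; by rewrite ?addr0.
Qed.

Fact overflow_mulC : commutative overflow_mul.
Proof.
by move=> [a|l] [b|m]; rewrite /overflow_mul orbC //= ?[a * b]mulrC 1?joinC.
Qed.

Fact overflow_mul1 : left_id overflow_one overflow_mul.
Proof.
case=> [a|l]; rewrite /overflow_mul ?inl0E ?inr0E oner_eq0 //= mul1r.
by case: eqP => // ->.
Qed.

Fact overflow_mul0 : left_zero overflow_zero overflow_mul.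
Proof. by move=> x; rewrite /overflow_mul eqxx. Qed.

Fact overflow_mulA : associative overflow_mul.
Proof.
move=> x y z; rewrite /overflow_mul.
case: (eqVneq x overflow_zero) => [->|x0] /=; first by rewrite ?eqxx.
case: (eqVneq y overflow_zero) => [->|y0] /=; first by rewrite eqxx.
case: (eqVneq z overflow_zero) => [->|z0] /=; first by rewrite eqxx !orbT.
rewrite !orbF; move: x y z x0 y0 z0 => [a|l] [b|m] [c|n];
  rewrite !(inl0E, inr0E) /= => x0 y0 z0;
  rewrite ?(inl0E, inr0E) ?mulf0E ?(negPf x0) ?(negPf y0) ?(negPf z0) //=;
  by rewrite ?mulrA ?joinA.
Qed.

Fact overflow_mulDl : left_distributive overflow_mul overflow_add.
Proof.
move=> x y z; rewrite /overflow_mul.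
case: (eqVneq z overflow_zero) => [->|z0] /=; first by rewrite !orbT /= addr0.
rewrite !orbF.
have [->|x0] := eqVneq x overflow_zero; first by rewrite !overflow_add0.
have [->|y0] := eqVneq y overflow_zero.
  by rewrite ![overflow_add _ overflow_zero]overflow_addC !overflow_add0
             (negPf x0).
move: x y z x0 y0 z0 => [a|l] [b|m] [c|n];
  rewrite !(inl0E, inr0E) /= => x0 y0 z0;
  rewrite ?(inl0E, inr0E) ?addf0E ?(negPf x0) ?(negPf y0) ?(negPf z0) //=.
- by rewrite mulrDl.
- by rewrite joinxx.
- by rewrite joinKUC joinC.
- by rewrite joinUK.
- by rewrite joinACA joinxx.
Qed.

Fact overflow_one_neq0 : overflow_one != 0.
Proof. by rewrite inl0E oner_eq0. Qed.

HB.instance Definition _ := GRing.Nmodule_isComNzSemiRing.Build S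
  overflow_mulA overflow_mulC overflow_mul1 overflow_mulDl overflow_mul0
  overflow_one_neq0.

Fact overflow_zerosumfree (x y : S) : x + y = 0 -> x = 0 /\ y = 0.
Proof. by case: x y => [a|l] [b|m] // [] /zerosumfree[-> ->]. Qed.

Fact overflow_entire (x y : S) : x * y = 0 -> x = 0 \/ y = 0.
Proof.
have -> : x * y = overflow_mul x y by [].
rewrite /overflow_mul.
case: (eqVneq x overflow_zero) => [->|x0] /=; first by left.
case: (eqVneq y overflow_zero) => [->|y0] /=; first by right.
by case: x y x0 y0 => [a|l] [b|m] // _ _ [] /entire[]->; [left|right].
Qed.

HB.instance Definition _ :=
  isInfoAlgebra.Build S overflow_zerosumfree overflow_entire.

Fact overflow_leD2r (z x y : S) :
  overflow_le x y -> overflow_le (x + z) (y + z).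
Proof.
case: x y z => [a|l] [b|m] [c|n] //=; first exact: pleD2r.
- by rewrite leUr.
- by move=> lm; rewrite leU2.
Qed.

Fact overflow_leM2r (z x y : S) :
  overflow_le x y -> overflow_le (x * z) (y * z).
Proof.
have [[rA tA] aA] := @ple_order A.
have mE (u v : S) : u * v = overflow_mul u v by [].
rewrite !mE /overflow_mul.
case: (eqVneq z overflow_zero) => [->|z0] /=; first by rewrite !orbT /= rA.
rewrite !orbF.
case: (eqVneq x overflow_zero) => [->|x0] /=.
  by case: ifP => _; case: y z {z0} => [b|m] [c|n] //=; rewrite ?rA ?ple0x.
case: (eqVneq y overflow_zero) => [->|y0] /=.
  case: x x0 => [a|l] //= a0 le0.
  by case/negP: a0; rewrite inl0E; apply/eqP/aA; rewrite le0 ple0x.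
case: x y z {x0 y0 z0} => [a|l] [b|m] [c|n] //=; first exact: pleM2r.
- by rewrite leUr.
- by move=> lm; rewrite leU2.
Qed.

Fact overflow_le0x (x : S) : overflow_le 0 x.
Proof. by case: x => [a|l] //=; exact: ple0x. Qed.

HB.instance Definition _ := InfoAlgebra_isPositive.Build S
  overflow_le_order overflow_leD2r overflow_leM2r overflow_le0x.

End Overflow.

(* Main.v *)
(** Every nonzero [a] in [A] satisfies [a * l = l] for [l] in [L], so an ideal
of the overflow semiring either contains all of [L], and is then the union of
an ideal of [A] and [L], or meets [A] only in [0]. In the latter case its trace
on [L] is an up-set, hence principal when [L] is well-ordered. *)

Require Import Defs.
From mathcomp Require Import all_boot all_order all_algebra.
From mathcomp Require Import boolp classical_sets functions cardinality.
From mathcomp Require wochoice.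

Set Implicit Arguments.
Unset Strict Implicit.
Unset Printing Implicit Defensive.

Import Order.TTheory GRing.Theory.
Local Open Scope classical_set_scope.
Local Open Scope ring_scope.

Section Ideals.
Variable S : comNzSemiRingType.
Implicit Types I G : set S.

Lemma ideal0 I : ideal I -> I 0.
Proof. by case=> -[x Ix] _ /(_ 0 x Ix); rewrite mul0r. Qed.

(** This replaces the equality with [smallest] by minimality of [I] among the ideals containing [G],
    the form checked in each case below. *)
Lemma finitely_generatedP I G : ideal I -> finite_set G -> G `<=` I ->
  (forall J : set S, ideal J -> G `<=` J -> I `<=` J) -> finitely_generated I.
Proof.
move=> Iid Gfin GI Imin; exists G => //; apply/seteqP; split.
- by move=> x Ix J [Jid GJ]; exact: (Imin J).
- exact: smallest_sub.
Qed.

End Ideals.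

Section OverflowIdeals.
Variables (A : posInfoAlgebraType) (d : Order.disp_t) (L : joinSemilatticeType d).
Notation S := (overflow A L).
Implicit Types (a b : A) (l m : L).

Lemma overflow_mulll a b : (inl a : S) * inl b = inl (a * b).
Proof.
change (overflow_mul (inl a : S) (inl b) = inl (a * b)).
rewrite /overflow_mul; case: ifP => // /orP[] /eqP[->];
  by rewrite ?mul0r ?mulr0.
Qed.

Lemma overflow_mullr a l : a != 0 -> (inl a : S) * inr l = inr l.
Proof.
move=> a0; change (overflow_mul (inl a : S) (inr l) = inr l).
by rewrite /overflow_mul orbF ifN.
Qed.

Lemma overflow_mulrr l m : (inr l : S) * inr m = inr (Order.join l m).
Proof. by []. Qed.

Lemma ideal_preimage_inl (I : set S) : ideal I -> ideal [set a | I (inl a)].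
Proof.
move=> Iid; split.
- by exists 0; exact: (ideal0 Iid).
- by case: Iid => _ ID _ a b; exact: ID.
- by case: Iid => _ _ IM s a Ia /=; rewrite -overflow_mulll; exact: IM.
Qed.

Definition overflow_ext (J : set A) : set S :=
  [set x | match x with inl a => J a | inr _ => True end].

(** A sum with a term in [L] stays in [L], and so does a product with a factor in [L], unless the
    other factor is 0; then the product is 0, which lies in [J]. *)
Lemma ideal_overflow_ext (J : set A) : ideal J -> ideal (overflow_ext J).
Proof.
move=> Jid; have J0 := ideal0 Jid; case: (Jid) => _ JD JM; split.
- by exists 0.
- by move=> [a|l] [b|m] //=; exact: JD.
- move=> [s|k] [a|l] //=.
  + by rewrite overflow_mulll; exact: JM.
  + have [->|s0] := eqVneq s 0; first by rewrite (mul0r (inr l : S)).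
    by rewrite overflow_mullr.
  + have [->|a0] := eqVneq a 0; first by rewrite (mulr0 (inr k : S)).
    by rewrite mulrC overflow_mullr.
Qed.

(** Extend [J] by [L], take finitely many generators of the result, and keep those in [A]. *)
Lemma noetherian_overflowW : noetherian S -> noetherian A.
Proof.
move=> Snoeth J Jid.
have [G Gfin JE] := Snoeth _ (ideal_overflow_ext Jid).
apply: (@finitely_generatedP _ _ [set a | G (inl a)]) => //.
- by apply: finite_preimage => // a b _ _ [].
- move=> a Ga; suff : overflow_ext J (inl a) by [].
  by rewrite JE => I [_]; exact.
(* The discarded generators lie in [L], so [overflow_ext K] contains all of [G] as soon as [K]
   contains the part of [G] in [A]. *)
- move=> K Kid GK a Ja; have : overflow_ext J (inl a) by [].
  rewrite JE => /(_ (overflow_ext K)); apply.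
  by split; [exact: ideal_overflow_ext|case=> [b /GK|]].
Qed.

(** Generators of the trace of [I] on [A] suffice: they yield [a], and each [l] in [L] is the
    multiple [l * a] of [a]. *)
Lemma finitely_generated_overflow (I : set S) a :
  noetherian A -> ideal I -> I (inl a) -> a != 0 -> finitely_generated I.
Proof.
move=> Anoeth Iid Ia a0.
have [G Gfin GE] := Anoeth _ (ideal_preimage_inl Iid).
apply: (@finitely_generatedP _ _ ((inl : A -> S) @` G)) => //.
- exact: finite_image.
- move=> _ [b Gb <-]; suff : [set a | I (inl a)] b by [].
  by rewrite GE => K [_]; exact.
- move=> J Jid GJ.
  have IJ b : I (inl b) -> J (inl b).
    move=> Ib; have : [set a | I (inl a)] b by [].
    rewrite GE => /(_ [set a | J (inl a)]); apply; split.
      exact: ideal_preimage_inl.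
    by move=> c Gc; apply: GJ; exists c.
  move=> [b|l]; first exact: IJ.
  case: Jid => _ _ JM _; rewrite -(overflow_mullr l a0) mulrC.
  by apply: JM; exact: IJ.
Qed.

End OverflowIdeals.

Lemma noetherian_overflow (A : posInfoAlgebraType) (d : Order.disp_t)
    (L : orderType d) :
  wochoice.well_order (<=%O : rel L) -> noetherian A ->
  noetherian (overflow A L).
Proof.
move=> hL Anoeth I Iid.
have [[a Ia a0]|IA0] := pselect (exists2 a, I (inl a) & a != 0).
  exact: finitely_generated_overflow Ia a0.
have {}IA0 a : I (inl a) -> a = 0.
  by move=> Ia; apply/eqP/negP => /negP a0; apply: IA0; exists a.
have [[l Il]|IL0] := pselect (exists l, I (inr l)); last first.
  (* Here [I] is the zero ideal, contained in every ideal. *)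
  apply: (@finitely_generatedP _ _ set0) => //.
  by move=> J /ideal0 J0 _ [a /IA0 ->|l Il] //; case: IL0; exists l.
(* The least element [m] of the trace on [L] will be the single generator. *)
have [|m [[Im mmin] _]] := hL [pred l | `[< I (inr l) >]].
  by exists l; exact/asboolP.
have {}Im : I (inr m) by exact/asboolP.
apply: (@finitely_generatedP _ _ [set (inr m : overflow A L)]) => //.
- by move=> _ ->.
- move=> J Jid mJ; have J0 := ideal0 Jid; case: Jid => _ _ JM.
  move=> [a /IA0 -> //|k Ik].
  (* Since [m <= k], the join of [k] and [m] is [k], so [k] is the product [k * m]. *)
  have /join_l <- : (m <= k)%O by apply: mmin; exact/asboolP.
  by rewrite -overflow_mulrr; apply: JM; exact: mJ.
Qed.

Theorem theorem4p18 (A : posInfoAlgebraType) (d : Order.disp_t)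
    (L : orderType d) (hL : wochoice.well_order (<=%O : rel L)) :
  noetherian (overflow A L) <-> noetherian A.
Proof.
split; [exact: noetherian_overflowW|exact: noetherian_overflow].
Qed.
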